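(* (i) For $n\ge1$ and $s\in\{1,\dots,n+1\}$, $\mathfrak{f}_n^{(s)}$ is an injective natural transformation from $\mathscr{P}^n$ to $\mathscr{P}^{n+1}$. (ii) For $n\ge 2$ and $2\le s\le n$, $\mathfrak{t}_n^{(s)}$ is a surjective natural transformation from $\mathscr{P}^n$ to $\mathscr{P}^{n-1}$. (iii) Both $\mathfrak{t}_{n+1}^{(s)}\mathfrak{f}_n^{(s)}$ and $\mathfrak{t}_{n+1}^{(s+1)}\mathfrak{f}_n^{(s)}$ are the identity transformations (whenever the indices are such that the respective transformations are defined). (iv) $\mathfrak{t}_{n+1}^{(r)}\mathfrak{f}_n^{(s)}=\mathfrak{f}_{n-1}^{(s)}\mathfrak{t}_n^{(r-1)}$ if $n\ge2$ and $s+1<r$ (with $1\le s\le n+1$, $2\le r\le n+1$). (v) $\mathfrak{t}_{n+1}^{(r)}\mathfrak{f}_n^{(s)}=\mathfrak{f}_{n-1}^{(s-1)}\mathfrak{t}_n^{(r)}$ if $n\ge2$ and $r<s$ (with $1\le s\le n+1$, $2\le r\le n+1$).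
   Context: Condition (PB) on a category $\mathscr{C}$: for any objects $i,j,k$, any $f\in\mathscr{C}(i,j)$ and any monomorphism $\alpha\in\mathscr{C}(k,j)$ there exists a pullback of $f$ along $\alpha$. Condition (CD) on a category $\mathscr{C}$: for all objects $i,j,k$ and monomorphisms $\alpha\in\mathscr{C}(i,j)$, $\beta\in\mathscr{C}(j,k)$ there exist an object $l$ and monomorphisms $\gamma\in\mathscr{C}(i,l)$, $\delta\in\mathscr{C}(l,k)$ such that: (a) the square $\beta\alpha=\delta\gamma$ is a pullback (of $\beta$ and $\delta$); (b) for all objects $m,n$ and monomorphisms $\xi\in\mathscr{C}(m,i)$, $\eta\in\mathscr{C}(m,n)$, $\zeta\in\mathscr{C}(n,k)$ such that $\zeta\eta=\beta\alpha\xi$ and this square (with $\zeta$, $\eta$, $\beta$ and $\alpha\xi$) is a pullback, there exists $\varphi\in\mathscr{C}(n,l)$ with $\delta\varphi=\zeta$ and $\varphi\eta=\gamma\xi$. $\mathscr{S}$ is the category whose objects are small categories satisfying (PB) and (CD), and whose morphisms are all functors which preserve monomorphisms. The partialization $\mathscr{P}(\mathscr{C})$: same objects as $\mathscr{C}$; a morphism from $i$ to $j$ is an equivalence class of diagrams $\mathrm{D}(i,j,k,\alpha,f)$: $i\xleftarrow{\alpha}k\xrightarrow{f}j$ with $\alpha$ a monomorphism, $(k,\alpha,f)$ and $(k',\alpha',f')$ being equivalent if there is an isomorphism $\gamma:k\to k'$ with $\alpha'\gamma=\alpha$, $f'\gamma=f$. The composition of $i\xleftarrow{\alpha}k\xrightarrow{f}j$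 (first) with $j\xleftarrow{\beta}n\xrightarrow{g}m$ (second) is $i\xleftarrow{\alpha\gamma}l\xrightarrow{gh}m$, where $\gamma:l\to k$, $h:l\to n$ is the pullback of $f$ along $\beta$. On functors, $\mathscr{P}(F)$ applies $F$ to all constituents of a diagram. The paper establishes that $\mathscr{P}$ is an endofunctor of $\mathscr{S}$, so the iterations $\mathscr{P}^n:\mathscr{S}\to\mathscr{S}$ are defined ($\mathscr{P}^0=\mathrm{ID}$). The monomorphisms of $\mathscr{P}(\mathscr{C})$ are exactly the images of monomorphisms $\gamma:i\to j$ of $\mathscr{C}$ under $\gamma\mapsto\mathrm{D}(i,j,i,\mathtt{1}_i,\gamma)$ and are identified with them. Hence the morphisms of $\mathscr{P}^n(\mathscr{C})$ from $i$ to $j$ are identified with equivalence classes of diagrams $\mathrm{D}(n,i,j,k_r,\alpha_r,f)$: $i\xleftarrow{\alpha_n}k_n\xleftarrow{\alpha_{n-1}}\cdots\xleftarrow{\alpha_1}k_1\xrightarrow{f}j$ in $\mathscr{C}$, with all $\alpha_r$ monomorphisms (the diagram stands for $i\xleftarrow{\alpha_n}k_n\to j$ where $k_n\to j$ is the morphism of $\mathscr{P}^{n-1}(\mathscr{C})$ given by the rest of the diagram); two diagrams are equivalent if there are isomorphisms $\gamma_r:k_r\to k_r'$ with $\alpha'_n\gamma_n=\alpha_n$, $\alpha'_r\gamma_r=\gamma_{r+1}\alpha_r$ for $r<n$, and $f'\gamma_1=f$. For $\mathscr{C}\in\mathscr{S}$, with the convention $k_{n+1}:=i$: for $n\ge1$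 and $s\in\{1,\dots,n+1\}$, $\mathfrak{f}_n^{(s)}$ is the identity on objects and maps $\mathrm{D}(n,i,j,k_r,\alpha_r,f)\in\mathscr{P}^n(\mathscr{C})(i,j)$ to the element of $\mathscr{P}^{n+1}(\mathscr{C})(i,j)$ obtained by replacing $k_s$ in the chain by $k_s\xleftarrow{\mathrm{id}}k_s$ (so $k_s$ is doubled). For $n\ge2$ and $2\le s\le n$, $\mathfrak{t}_n^{(s)}$ is the identity on objects and maps $\mathrm{D}(n,i,j,k_r,\alpha_r,f)$ to the element of $\mathscr{P}^{n-1}(\mathscr{C})(i,j)$ obtained by deleting $k_s$ and using the composite $\alpha_s\alpha_{s-1}:k_{s-1}\to k_{s+1}$. ''Injective''/''surjective'' refers to the maps on morphism sets.
   Formalization: (PB) and (CD) as stated do not make P(C) satisfy (PB), so objects of S are those C all of whose iterated partializations satisfy (PB) and (CD). P(F) need not preserve composition; naturality is stated for P^n(F) as a map on diagram classes, for every mono-preserving F. *)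

(* Defs.v *)
(* Stdlib only, with ssreflect tactics. *)
From Corelib Require Export ssreflect ssrfun ssrbool.
From Stdlib Require Export FinFun PeanoNat.
From Stdlib Require Import FunctionalExtensionality PropExtensionality.
From Stdlib Require Import ProofIrrelevance IndefiniteDescription.

Set Implicit Arguments.
Unset Strict Implicit.
Unset Printing Implicit Defensive.

Record category (O : Type) := Category {
  hom : O -> O -> Type;
  idm : forall i, hom i i;
  comp : forall i j k, hom j k -> hom i j -> hom i k;
  comp1m : forall i j (f : hom i j), comp (idm j) f = f;
  compm1 : forall i j (f : hom i j), comp f (idm i) = f;
  compA : forall i j k l (h : hom k l) (g : hom j k) (f : hom i j),
    comp h (comp g f) = comp (comp h g) f
}.

Arguments idm {O} _ _.
Arguments comp {O _ i j k} _ _.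
Notation "g ** f" := (comp g f) (at level 40, left associativity).

Section Categories.
Context (O : Type) (C : category O).

Definition mono i j (a : hom C i j) :=
  forall m (g h : hom C m i), a ** g = a ** h -> g = h.

Definition inverse i j (a : hom C i j) (b : hom C j i) :=
  b ** a = idm C i /\ a ** b = idm C j.

Definition iso i j (a : hom C i j) := exists b, inverse a b.

Definition is_pullback i j k l
    (f : hom C i j) (a : hom C k j) (p : hom C l i) (q : hom C l k) :=
  f ** p = a ** q /\
  forall m (x : hom C m i) (y : hom C m k), f ** x = a ** y ->
    exists! u : hom C m l, p ** u = x /\ q ** u = y.

Definition PB :=
  forall i j k (f : hom C i j) (a : hom C k j), mono a ->
    exists l (p : hom C l i) (q : hom C l k), is_pullback f a p q.

Definition CD :=
  forall i j k (a : hom C i j) (b : hom C j k), mono a -> mono b ->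
  exists l (c : hom C i l) (d : hom C l k),
    [/\ mono c, mono d, is_pullback b d a c &
      forall m n (x : hom C m i) (y : hom C m n) (z : hom C n k),
        mono x -> mono y -> mono z -> is_pullback b z (a ** x) y ->
        exists u : hom C n l, d ** u = z /\ u ** y = c ** x].

Lemma mono_id i : mono (idm C i).
Proof. by move=> m g h; rewrite !comp1m. Qed.

Lemma mono_comp i j k (a : hom C i j) (b : hom C j k) :
  mono a -> mono b -> mono (b ** a).
Proof. by move=> ma mb m g h; rewrite -!compA => /mb /ma. Qed.

Lemma mono_cancel i j k (a : hom C i j) (b : hom C j k) :
  mono (b ** a) -> mono a.
Proof. by move=> m n g h e; apply: m; rewrite -!compA e. Qed.

Lemma iso_mono i j (a : hom C i j) : iso a -> mono a.
Proof.
move=> [b [ba _]]; apply: (@mono_cancel _ _ _ _ b); rewrite ba; exact: mono_id.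
Qed.

Lemma iso_id i : iso (idm C i).
Proof. by exists (idm C i); split; rewrite comp1m. Qed.

Lemma iso_comp i j k (a : hom C i j) (b : hom C j k) :
  iso a -> iso b -> iso (b ** a).
Proof.
move=> [a' [a1 a2]] [b' [b1 b2]]; exists (a' ** b'); split.
- by rewrite -compA (compA b') b1 comp1m.
- by rewrite -compA (compA a) a2 comp1m.
Qed.

Lemma pullback_mono i j k l (f : hom C i j) (a : hom C k j)
    (p : hom C l i) (q : hom C l k) :
  is_pullback f a p q -> mono a -> mono p.
Proof.
move=> [e u] ma m g h epg.
have eqg : q ** g = q ** h by apply: ma; rewrite !compA -e -!compA epg.
have [|v [_ vu]] := u m (p ** g) (q ** g); first by rewrite !compA e.
by rewrite -(vu g) // -(vu h).
Qed.

Lemma pullback_sym i j k l (f : hom C i j) (a : hom C k j)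
    (p : hom C l i) (q : hom C l k) :
  is_pullback f a p q -> is_pullback a f q p.
Proof.
move=> [e u]; split=> // m x y exy; have [|v [[v1 v2] vu]] := u m y x => //.
by exists v; split=> // w [w1 w2]; apply: vu.
Qed.

Lemma pullback_unique i j k l l' (f : hom C i j) (a : hom C k j)
    (p : hom C l i) (q : hom C l k) (p' : hom C l' i) (q' : hom C l' k) :
  is_pullback f a p q -> is_pullback f a p' q' ->
  exists u : hom C l l', [/\ iso u, p' ** u = p & q' ** u = q].
Proof.
move=> [e U] [e' U'].
have [u [[u1 u2] _]] := U' _ _ _ e; have [v [[v1 v2] _]] := U _ _ _ e'.
exists u; split=> //; exists v; split.
- have [w [_ wu]] := U _ _ _ e.
  rewrite -(wu (v ** u)) ?(wu (idm _ _)) // ?compm1 //.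
  by rewrite !compA v1 v2 u1 u2.
- have [w [_ wu]] := U' _ _ _ e'.
  rewrite -(wu (u ** v)) ?(wu (idm _ _)) // ?compm1 //.
  by rewrite !compA u1 u2 v1 v2.
Qed.

Lemma pullback_iso i j k l i' k' (f : hom C i j) (a : hom C k j)
    (p : hom C l i) (q : hom C l k) (f' : hom C i' j) (a' : hom C k' j)
    (g : hom C i i') (h : hom C k k') :
  is_pullback f a p q -> iso g -> iso h -> f' ** g = f -> a' ** h = a ->
  is_pullback f' a' (g ** p) (h ** q).
Proof.
move=> [e U] [g' [g1 g2]] [h' [h1 h2]] ef ea; split.
  by rewrite !compA ef ea.
move=> m x y exy; have [|u [[u1 u2] uu]] := U m (g' ** x) (h' ** y).
  by rewrite -ef -ea -!compA (compA g) (compA h) g2 h2 !comp1m.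
exists u; split.
  by rewrite -!compA u1 u2 !compA g2 h2 !comp1m.
move=> v [v1 v2]; apply: uu; split.
- by rewrite -v1 -compA (compA g') g1 comp1m.
- by rewrite -v2 -compA (compA h') h1 comp1m.
Qed.

Lemma pullback_id_r i j (f : hom C i j) : is_pullback f (idm C j) (idm C i) f.
Proof.
split=> [|m x y]; first by rewrite comp1m compm1.
rewrite comp1m => <-; exists x; split; first by rewrite comp1m.
by move=> z [<- _]; rewrite comp1m.
Qed.

Lemma pullback_self i j (a : hom C i j) :
  mono a -> is_pullback a a (idm C i) (idm C i).
Proof.
move=> ma; split=> // m x y /ma <-; exists x; split; first by rewrite comp1m.
by move=> z [<- _]; rewrite comp1m.
Qed.

Lemma pullback_paste i j k l m n (f : hom C i j) (a : hom C k j)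
    (p : hom C l i) (q : hom C l k) (g : hom C m i)
    (p' : hom C n m) (q' : hom C n l) :
  is_pullback f a p q -> is_pullback g p p' q' ->
  is_pullback (f ** g) a p' (q ** q').
Proof.
move=> [e U] [e' U']; split.
  by rewrite -compA e' !compA e.
move=> o x y exy.
have [|u [[u1 u2] uu]] := U o (g ** x) y; first by rewrite compA.
have [|v [[v1 v2] vu]] := U' o x u; first by rewrite u1.
exists v; split; first by rewrite -compA v2.
move=> w [w1 w2]; apply: vu; split=> //; apply/esym/uu; split.
- by rewrite compA -e' -compA w1.
- by rewrite compA.
Qed.

End Categories.

Definition classes T (R : T -> T -> Prop) := {X : T -> Prop | exists x, X = R x}.

Section Classes.
Context (T : Type) (R : T -> T -> Prop).
Hypothesis Rrefl : forall x, R x x.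
Hypothesis Rsym : forall x y, R x y -> R y x.
Hypothesis Rtrans : forall x y z, R x y -> R y z -> R x z.

Definition class x : classes R := exist _ (R x) (ex_intro _ x erefl).

Definition repr (X : classes R) : T :=
  proj1_sig (constructive_indefinite_description _ (proj2_sig X)).

Lemma reprK X : class (repr X) = X.
Proof.
rewrite /repr; case: constructive_indefinite_description => x /= e.
by case: X e => Y hY /= e; apply: subset_eq_compat.
Qed.

Lemma classP x y : class x = class y <-> R x y.
Proof.
split=> [[e]|h]; first by rewrite e; apply: Rrefl.
apply: subset_eq_compat; apply: functional_extensionality => z.
apply: propositional_extensionality; split=> h'.
- by apply: Rtrans h'; apply: Rsym.
- by apply: Rtrans h'.
Qed.

End Classes.

(* One step [i <-(a)- k] of a diagram, followed by data [T k] attached to [k]. *)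
Record link O (C : category O) (T : O -> Type) (i : O) := Link {
  mid : O;
  leg : hom C mid i;
  legP : mono leg;
  rest : T mid
}.
Arguments Link {O C T i mid} leg legP rest.
Arguments legP {O C T i} l [m] g h _.

(* The diagrams [i <-(a)- k -(f)-> j] with [a] a monomorphism. *)
Definition diagram O (C : category O) (i j : O) := link C (fun k => hom C k j) i.

Definition diagram_equiv O (C : category O) i j (d d' : diagram C i j) :=
  exists g : hom C (mid d) (mid d'),
    [/\ iso g, leg d' ** g = leg d & rest d' ** g = rest d].

Definition phom O (C : category O) i j := classes (@diagram_equiv O C i j).

Section Diagrams.
Context (O : Type) (C : category O).
Implicit Types i j k : O.

Lemma diagram_refl i j (d : diagram C i j) : diagram_equiv d d.
Proof. by exists (idm C _); rewrite !compm1; split=> //; apply: iso_id. Qed.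

Lemma diagram_sym i j (d d' : diagram C i j) :
  diagram_equiv d d' -> diagram_equiv d' d.
Proof.
move=> [g [[h [h1 h2]] e1 e2]]; exists h; split; first by exists g.
- by rewrite -e1 -compA h2 compm1.
- by rewrite -e2 -compA h2 compm1.
Qed.

Lemma diagram_trans i j (d d' d'' : diagram C i j) :
  diagram_equiv d d' -> diagram_equiv d' d'' -> diagram_equiv d d''.
Proof.
move=> [g [ig e1 e2]] [h [ih e3 e4]]; exists (h ** g).
by rewrite !compA e3 e4; split=> //; apply: iso_comp.
Qed.

Definition dclass i j (d : diagram C i j) : phom C i j :=
  class (@diagram_equiv O C i j) d.

Lemma dclassP i j (d d' : diagram C i j) :
  dclass d = dclass d' <-> diagram_equiv d d'.
Proof.
by apply: classP; [exact: diagram_refl | exact: diagram_sym | exact: diagram_trans].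
Qed.

Lemma dreprK i j (c : phom C i j) : dclass (repr c) = c.
Proof. exact: reprK. Qed.

Lemma phomP i j (c : phom C i j) :
  exists k (a : hom C k i) (ma : mono a) (f : hom C k j), c = dclass (Link a ma f).
Proof.
by rewrite -(dreprK c); case: (repr c) => k a ma f; exists k, a, ma, f.
Qed.

Context (pb : PB C).

Lemma dcomp_exists i j k (e : diagram C j k) (d : diagram C i j) :
  exists c : diagram C i k,
  exists (p : hom C (mid c) (mid d)) (q : hom C (mid c) (mid e)),
    [/\ is_pullback (rest d) (leg e) p q, leg c = leg d ** p & rest c = rest e ** q].
Proof.
have [l [p [q pbq]]] := pb (rest d) (legP e).
have ml : mono (leg d ** p).
  by apply: mono_comp (legP d); exact: pullback_mono pbq (legP e).
by exists (Link (leg d ** p) ml (rest e ** q)), p, q.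
Qed.

Definition dcomp i j k (e : diagram C j k) (d : diagram C i j) : diagram C i k :=
  proj1_sig (constructive_indefinite_description _ (dcomp_exists e d)).

Definition pcomp i j k (e : phom C j k) (d : phom C i j) : phom C i k :=
  dclass (dcomp (repr e) (repr d)).

(* The composite does not depend on the choices of representatives and of the
   pullback. *)
Lemma pcompE i j k l n m (a : hom C k i) (ma : mono a) (f : hom C k j)
    (b : hom C n j) (mb : mono b) (g : hom C n m)
    (p : hom C l k) (q : hom C l n) (mp : mono (a ** p)) :
  is_pullback f b p q ->
  pcomp (dclass (Link b mb g)) (dclass (Link a ma f))
    = dclass (Link (a ** p) mp (g ** q)).
Proof.
move=> pbq; rewrite /pcomp /dcomp.
case: constructive_indefinite_description => c [p' [q' [pbq' e1 e2]]] /=.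
have /dclassP [g1 /= [ig1 e3 e4]] := dreprK (dclass (Link a ma f)).
have /dclassP [g2 /= [ig2 e5 e6]] := dreprK (dclass (Link b mb g)).
have pb2 := pullback_iso pbq' ig1 ig2 e4 e5.
have [u [iu u1 u2]] := pullback_unique pb2 pbq.
apply/dclassP; exists u; split=> //=.
- by rewrite -compA u1 e1 -e3 compA.
- by rewrite -compA u2 e2 -e6 compA.
Qed.

Definition emb i j (f : hom C i j) : phom C i j :=
  dclass (Link (idm C i) (@mono_id _ _ i) f).

Lemma pcomp_embr i j k l n (b : hom C n j) (mb : mono b) (g : hom C n k)
    (f : hom C i j) (p : hom C l i) (mp : mono p) (q : hom C l n) :
  is_pullback f b p q ->
  pcomp (dclass (Link b mb g)) (emb f) = dclass (Link p mp (g ** q)).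
Proof.
move=> pbq; have mp' : mono (idm C i ** p) by rewrite comp1m.
rewrite /emb (pcompE _ _ _ mp' pbq); apply/dclassP.
by exists (idm C _); split; rewrite /= ?compm1 ?comp1m //; apply: iso_id.
Qed.

Lemma pcomp_embl i j k l (a : hom C l i) (ma : mono a) (f : hom C l j)
    (g : hom C j k) :
  pcomp (emb g) (dclass (Link a ma f)) = dclass (Link a ma (g ** f)).
Proof.
have ma' : mono (a ** idm C l) by rewrite compm1.
rewrite /emb (pcompE _ _ _ ma' (pullback_id_r f)); apply/dclassP.
by exists (idm C _); split; rewrite /= ?compm1 //; apply: iso_id.
Qed.

Lemma pcomp1m i j (c : phom C i j) : pcomp (emb (idm C j)) c = c.
Proof. by have [k [a [ma [f ->]]]] := phomP c; rewrite pcomp_embl comp1m. Qed.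

Lemma pcompm1 i j (c : phom C i j) : pcomp c (emb (idm C i)) = c.
Proof.
have [k [a [ma [f ->]]]] := phomP c.
by rewrite (pcomp_embr _ _ ma (pullback_sym (pullback_id_r a))) compm1.
Qed.

Lemma pcompA i j k l (h : phom C k l) (g : phom C j k) (f : phom C i j) :
  pcomp h (pcomp g f) = pcomp (pcomp h g) f.
Proof.
have [x [a [ma [f0 ->]]]] := phomP f.
have [y [b [mb [g0 ->]]]] := phomP g.
have [z [c [mc [h0 ->]]]] := phomP h.
have [u [p [q pq]]] := pb f0 mb.
have [v [r [s rs]]] := pb g0 mc.
have mp := pullback_mono pq mb; have mr := pullback_mono rs mc.
have [w [t [o to]]] := pb q mr.
have mt := pullback_mono to mr.
have map := mono_comp mp ma; have mbr := mono_comp mr mb.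
have mapt := mono_comp mt map; have mapt' : mono (a ** (p ** t)) by rewrite compA.
rewrite (pcompE ma mb g0 map pq) (pcompE mb mc h0 mbr rs).
rewrite (pcompE map mc h0 mapt (pullback_paste rs to)).
have pq' : is_pullback f0 (b ** r) (p ** t) o.
  apply/pullback_sym.
  have := pullback_paste (pullback_sym pq) (pullback_sym to).
  move=> [e U]; split; last exact: U.
  by rewrite e.
rewrite (pcompE ma mbr _ mapt' pq'); apply/dclassP.
by exists (idm C _); split; rewrite /= ?compm1 ?compA //; apply: iso_id.
Qed.

Definition partialization : category O :=
  @Category O (@phom O C) (fun i => emb (idm C i)) pcomp pcomp1m pcompm1 pcompA.

End Diagrams.

Section Embedding.
Context (O : Type) (C : category O) (pb : PB C).
Local Notation P := (partialization pb).
Local Notation Emb f := (emb f : hom P _ _).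

Lemma emb_comp i j k (g : hom C j k) (f : hom C i j) :
  Emb (g ** f) = Emb g ** Emb f.
Proof. by rewrite /= pcomp_embl. Qed.

Lemma emb_inj i j (f g : hom C i j) : emb f = emb g -> f = g.
Proof.
move=> /dclassP [h /= [_ e1 e2]].
by move: e1 e2; rewrite comp1m => ->; rewrite compm1.
Qed.

Lemma emb_mono i j (f : hom C i j) : mono f -> mono (Emb f).
Proof.
move=> mf m g h.
have [k [a [ma [g0 ->]]]] := phomP g; have [l [b [mb [h0 ->]]]] := phomP h.
rewrite /= !pcomp_embl => /dclassP [u /= [iu e1 e2]].
apply/dclassP; exists u; split=> //=; apply: mf; by rewrite compA.
Qed.

Lemma mono_embP i j (c : hom P i j) :
  mono c -> exists f : hom C i j, mono f /\ c = Emb f.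
Proof.
have [k [a [ma [f ->]]]] := phomP c => mc.
have ma1 : mono (a ** idm C k) by rewrite compm1.
have e : (dclass (Link a ma a) : hom P i i) = idm P i.
  apply: mc; rewrite compm1 /= (pcompE _ ma ma f ma1 (pullback_self ma)).
  apply/dclassP; exists (idm C k).
  by split; rewrite /= ?compm1 //; apply: iso_id.
have /dclassP := e; rewrite /diagram_equiv /= => -[g [ig e1 _]].
have [b [ba ab]] : iso a by rewrite comp1m in e1; rewrite -e1.
have ef : dclass (Link a ma f) = Emb (f ** b).
  apply/dclassP; exists a; split; first by exists b.
    by rewrite /= comp1m.
  by rewrite /= -compA ba compm1.
exists (f ** b); split=> //.
rewrite ef in mc => m x y exy; apply: emb_inj; apply: mc.
by rewrite -!emb_comp exy.
Qed.

Lemma emb_iso i j (f : hom C i j) : iso f -> iso (Emb f).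
Proof.
by move=> [g [gf fg]]; exists (Emb g); split; rewrite -emb_comp (gf, fg).
Qed.

Lemma iso_embP i j (c : hom P i j) :
  iso c -> exists f : hom C i j, iso f /\ c = Emb f.
Proof.
move=> [d [dc cd]].
have [f [mf ef]] := mono_embP (iso_mono (ex_intro _ d (conj dc cd))).
have [g [mg eg]] := mono_embP (iso_mono (ex_intro _ c (conj cd dc))).
subst c d; exists f; split=> //; exists g.
by split; apply: emb_inj; rewrite emb_comp.
Qed.

Lemma comp_emb_iso i j k (f : hom C i j) (g : hom C j i) (b : hom C k j) (mb : mono b)
    l (h : hom C k l) : inverse f g ->
  forall mgb : mono (g ** b),
  (dclass (Link b mb h) : hom P j l) ** Emb f = dclass (Link (g ** b) mgb h).
Proof.
move=> [gf fg] mgb; rewrite /= (pcomp_embr pb mb h mgb (q := idm C k)) ?compm1 //.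
split=> [|m x y e]; first by rewrite compA fg comp1m compm1.
exists y; split=> [|v [_]]; last by rewrite comp1m.
by rewrite comp1m -compA -e compA gf comp1m.
Qed.

End Embedding.

(* (CD) with arbitrary morphisms [x] and [z] in its last clause. *)
Definition CD_all O (C : category O) :=
  forall i j k (a : hom C i j) (b : hom C j k), mono a -> mono b ->
  exists l (c : hom C i l) (d : hom C l k),
    [/\ mono c, mono d, is_pullback b d a c &
      forall m n (x : hom C m i) (y : hom C m n) (z : hom C n k),
        is_pullback b z (a ** x) y ->
        exists u : hom C n l, d ** u = z /\ u ** y = c ** x].

Lemma CD_all_CD O (C : category O) : CD_all C -> CD C.
Proof.
move=> H i j k a b ma mb; have [l [c [d [mc md e U]]]] := H _ _ _ _ _ ma mb.
by exists l, c, d; split=> // m n x y z _ _ _; apply: U.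
Qed.

Section ClosedObjects.
Context (O : Type) (C : category O) (pb : PB C).
Local Notation P := (partialization pb).
Local Notation Emb f := (emb f : hom P _ _).

Lemma emb_factor i j k (a : hom C i j) (x : hom P k i) (t : hom C k j) :
  Emb a ** x = Emb t -> exists2 h : hom C k i, x = Emb h & a ** h = t.
Proof.
have [l [b [mb [f ->]]]] := phomP x.
rewrite /= pcomp_embl => /dclassP; rewrite /diagram_equiv /= => -[g [ig e1 e2]].
rewrite comp1m in e1; subst g; have [b' [b1 b2]] := ig.
exists (f ** b').
  apply/dclassP; exists b; split=> //; first by rewrite /= comp1m.
  by rewrite /= -compA b1 compm1.
by rewrite compA -e2 -compA b2 compm1.
Qed.

Lemma emb_pullback i j k l (f : hom C i j) (a : hom C k j)
    (p : hom C l i) (q : hom C l k) :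
  mono a -> is_pullback f a p q -> is_pullback (Emb f) (Emb a) (Emb p) (Emb q).
Proof.
move=> ma pbq; have mp := pullback_mono pbq ma; case: pbq => e U; split.
  by rewrite -!emb_comp e.
move=> m x y; have [r [u [mu [x0 ->]]]] := phomP x.
have [s [v [mv [y0 ->]]]] := phomP y.
rewrite /= !pcomp_embl => /dclassP; rewrite /diagram_equiv /= => -[g [ig e1 e2]].
have [|w [[w1 w2] _]] := U r x0 (y0 ** g); first by rewrite compA e2.
exists (dclass (Link u mu w) : hom P m l); split; last first.
  by move=> z [z1 _]; apply: (@emb_mono _ _ pb _ _ _ mp m); rewrite /= z1 pcomp_embl w1.
rewrite /= !pcomp_embl w1 w2; split=> //.
by apply/dclassP; exists g.
Qed.

Lemma CD_all_PB : CD_all C -> PB P.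
Proof.
move=> cd i j n c b' mb'; have [b [mb eb]] := mono_embP mb'; subst b'.
have [k [a [ma [f ->]]]] := phomP c.
have [l0 [p [q pq]]] := pb f mb; have mp := pullback_mono pq mb.
have [l [g [d [mg md gd U]]]] := cd _ _ _ _ _ mp ma.
have [pq1 pq2] := pq; have [gd1 gd2] := gd.
exists l, (Emb d), (dclass (Link g mg q)); split.
  by rewrite /= (pcomp_embr pb ma f mg (pullback_sym gd)) pcomp_embl pq1.
move=> m x y; have [q0 [u [mu [x0 ->]]]] := phomP x.
have [r [v [mv [y0 ->]]]] := phomP y.
have [s [sg [t st]]] := pb x0 ma; have msg := pullback_mono st ma.
have mus := mono_comp msg mu.
rewrite /= (pcompE _ mu ma f mus st) pcomp_embl => /dclassP.
rewrite /diagram_equiv /= => -[e [ie e1 e2]].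
have [|h [[h1 h2] _]] := pq2 s t (y0 ** e); first by rewrite compA e2.
have st' : is_pullback a x0 (p ** h) sg by rewrite h1; apply: pullback_sym.
have [w [w1 w2]] := U _ _ _ _ _ st'.
exists (dclass (Link u mu w) : hom P m l); split; last first.
  by move=> z [z1 _]; apply: (@emb_mono _ _ pb _ _ _ md m); rewrite /= z1 pcomp_embl w1.
rewrite /= pcomp_embl w1; split=> //.
have wg : is_pullback w g sg h.
  split=> // m' z1 z2 ez; have [|t0 [[t1 t2] _]] := st.2 m' z1 (p ** z2).
    by rewrite -w1 -compA ez !compA gd1.
  exists t0; split; last by move=> t' [t'1 _]; apply: msg; rewrite t1 t'1.
  by split=> //; apply: mp; rewrite compA h1.
rewrite (pcompE _ mu mg q mus wg); apply/dclassP; exists e; split=> //=.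
Qed.

Lemma CD_all_P : CD_all C -> CD_all P.
Proof.
move=> cd i j k a' b' ma' mb'.
have [a [ma ea]] := mono_embP ma'; have [b [mb eb]] := mono_embP mb'; subst a' b'.
have [l [c [d [mc md cdpb U]]]] := cd _ _ _ _ _ ma mb.
exists l, (Emb c), (Emb d); split; try exact: emb_mono.
  exact: emb_pullback.
move=> m n x y z [ez Uz]; have [r [v [mv [z0 ez0]]]] := phomP z.
have [s [sg [t st]]] := pb z0 mb.
have ve : is_pullback (v ** sg) v (idm C s) sg.
  split; first by rewrite compm1.
  move=> m' z1 z2; rewrite -compA => /mv <-; exists z1.
  by split=> [|z' [<- _]]; rewrite comp1m.
have [|W [[W1 _] _]] := Uz s (Emb t) (Emb (v ** sg)).
  rewrite ez0 /= (pcomp_embr pb mv z0 (@mono_id _ C s) ve) pcomp_embl st.1 //.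
have [h eh ht] : exists2 h : hom C s i, x ** W = Emb h & a ** h = t.
  by apply: emb_factor; rewrite compA.
have st' : is_pullback b z0 (a ** h) sg by rewrite ht; apply: pullback_sym.
have [u0 [u1 u2]] := U _ _ _ _ _ st'.
have ezd : Emb d ** (dclass (Link v mv u0) : hom P n l) = z.
  by rewrite ez0 /= pcomp_embl u1.
exists (dclass (Link v mv u0)); split=> //.
apply: (@emb_mono _ _ pb _ _ _ md m); rewrite compA ezd -ez !compA -!emb_comp.
by rewrite cdpb.1.
Qed.

Lemma PB_CD_all : PB P -> CD_all C.
Proof.
move=> pbP i j k a b ma mb.
pose c : hom P k j :=
  dclass (@Link _ _ (fun x => hom C x j) k j b mb (idm C j)).
have cE m n (f : hom C m k) (p : hom C n m) (q : hom C n j) (mp : mono p) :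
    is_pullback f b p q -> c ** Emb f = dclass (Link p mp q).
  by move=> pq; rewrite /c /= (pcomp_embr pb mb _ mp pq) comp1m.
have [l [A [H AH]]] := pbP _ _ _ c _ (@emb_mono _ _ pb _ _ _ ma).
have [d [md ed]] := mono_embP (pullback_mono AH (@emb_mono _ _ pb _ _ _ ma)); subst A.
have [s [g [mg [h eH]]]] := phomP H; subst H.
have [eAH UAH] := AH.
have [s' [g' [t' pbd]]] := pb d mb.
have mg' := pullback_mono pbd mb.
move: eAH; rewrite (cE _ _ _ _ _ mg' pbd) /= pcomp_embl => /esym/dclassP.
rewrite /diagram_equiv /= => -[e [[e' [e'e ee']] e1 e2]].
have sq : is_pullback (b ** a) b (idm C i) a.
  split; first by rewrite compm1.
  move=> m z1 z2; rewrite -compA => /mb <-; exists z1.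
  by split=> [|z' [<- _]]; rewrite comp1m.
have [|W [[W1 _] _]] := UAH i (Emb (b ** a)) (Emb (idm C i)).
  by rewrite (cE _ _ _ _ _ (@mono_id _ C i) sq) -emb_comp compm1.
have [c0 eW dc] := emb_factor W1.
have mc0 : mono c0 by apply: (@mono_cancel _ _ _ _ _ c0 d); rewrite dc; apply: mono_comp.
exists l, c0, d; split=> //.
  split=> // m x y exy; have [|w [[w1 w2] _]] := pbd.2 m y x; first by rewrite exy.
  exists (h ** (e' ** w)); split; last first.
    move=> z [z1 _]; apply: ma.
    by rewrite z1 !compA -e2 -(compA t') ee' compm1.
  have ahx : a ** (h ** (e' ** w)) = x.
    by rewrite !compA -e2 -(compA t') ee' compm1.
  split=> //; apply: md; rewrite compA dc -compA ahx exy //.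
move=> m n x y z zb; have my := pullback_mono (pullback_sym zb) mb.
have [|W' [[W'1 _] _]] := UAH n (Emb z) (dclass (Link y my x)).
  by rewrite (cE _ _ _ _ _ my (pullback_sym zb)) /= pcomp_embl.
have [u eu du] := emb_factor W'1.
exists u; split=> //; apply: md; rewrite !compA du dc -zb.1 compA //.
Qed.

End ClosedObjects.

(* The largest class of categories which satisfy (PB) and (CD) and is closed
   under partialization.  Closure has to be imposed: the last clause of (CD) only
   concerns monomorphisms [z], and there are finite categories with (PB) and (CD)
   whose partialization does not satisfy (PB), so that it has no partialization.
   By [admissibleP], closure amounts to allowing arbitrary [x] and [z] in (CD). *)
CoInductive admissible O (C : category O) : Prop := Admissible {
  adm_PB : PB C;
  adm_CD : CD C;
  adm_P : admissible (partialization adm_PB)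
}.

Lemma admissibleP O (C : category O) : admissible C <-> PB C /\ CD_all C.
Proof.
split=> [[pb _ [pbP _ _]]|]; first by split=> //; apply: PB_CD_all pbP.
move: C; cofix IH => C [pb cd].
exact: (Admissible (CD_all_CD cd) (IH _ (conj (CD_all_PB (pb := pb) cd)
                                              (@CD_all_P _ _ pb cd)))).
Qed.

Record Scat (O : Type) := SCat {
  cat :> category O;
  catP : admissible cat
}.

Definition P_obj O (C : Scat O) : Scat O := SCat (adm_P (catP C)).

Fixpoint Pn n O (C : Scat O) : Scat O :=
  match n with 0 => C | S n => P_obj (Pn n C) end.

Section Functors.
Context (O O' : Type) (ob : O -> O') (C : category O) (D : category O').

Definition hom_map := forall i j, hom C i j -> hom D (ob i) (ob j).

Record is_Smorphism (F : hom_map) : Prop := IsSmorphism {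
  Smor_id : forall i, F i i (idm C i) = idm D (ob i);
  Smor_comp : forall i j k (g : hom C j k) (f : hom C i j),
    F _ _ (g ** f) = F _ _ g ** F _ _ f;
  Smor_mono : forall i j (f : hom C i j), mono f -> mono (F _ _ f)
}.

Record Smorphism := SMorphism {
  Smor_map :> forall i j, hom C i j -> hom D (ob i) (ob j);
  SmorP : is_Smorphism Smor_map
}.

(* Applying a functor [F] to all the constituents of diagrams is compatible with
   their equivalence, but a functor which preserves monomorphisms need not
   preserve pullbacks, so that [P F] need not preserve all composites.  The
   following weakening is stable under [P] and suffices to define all the
   [P^n F]. *)
Record premorphism := PreMorphism {
  pre_map :> forall i j, hom C i j -> hom D (ob i) (ob j);
  pre_id : forall i, pre_map (idm C i) = idm D (ob i);
  pre_isol : forall i j k (g : hom C j k) (f : hom C i j), iso g ->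
    pre_map (g ** f) = pre_map g ** pre_map f;
  pre_isor : forall i j k (g : hom C j k) (f : hom C i j), iso f ->
    pre_map (g ** f) = pre_map g ** pre_map f;
  pre_mono : forall i j (f : hom C i j), mono f -> mono (pre_map f)
}.

End Functors.

Arguments pre_id {O O' ob C D} F i : rename.
Arguments pre_isol {O O' ob C D} F {i j k} g f _ : rename.
Arguments pre_isor {O O' ob C D} F {i j k} g f _ : rename.
Arguments pre_mono {O O' ob C D} F {i j f} _ [m] g h _ : rename.

Section DiagramMap.
Context (O O' : Type) (ob : O -> O') (C : category O) (D : category O').

Definition premorphism_of (F : Smorphism ob C D) : premorphism ob C D :=
  @PreMorphism _ _ _ _ _ F (Smor_id (SmorP F))
    (fun i j k g f _ => Smor_comp (SmorP F) g f)
    (fun i j k g f _ => Smor_comp (SmorP F) g f)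
    (Smor_mono (SmorP F)).

Lemma pre_iso (F : premorphism ob C D) i j (f : hom C i j) : iso f -> iso (F _ _ f).
Proof.
move=> [g [gf fg]]; exists (F _ _ g); split.
- by rewrite -pre_isor ?gf ?pre_id //; exists g.
- by rewrite -pre_isol ?fg ?pre_id //; exists g.
Qed.

Definition diagram_map (F : premorphism ob C D) i j (d : diagram C i j) :
    diagram D (ob i) (ob j) :=
  Link (F _ _ (leg d)) (pre_mono F (legP d)) (F _ _ (rest d)).

Lemma diagram_map_equiv (F : premorphism ob C D) i j (d d' : diagram C i j) :
  diagram_equiv d d' -> diagram_equiv (diagram_map F d) (diagram_map F d').
Proof.
move=> [g [ig e1 e2]]; exists (F _ _ g) => /=.
by rewrite -!pre_isor // e1 e2; split=> //; apply: pre_iso.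
Qed.

Definition phom_map (F : premorphism ob C D) i j (c : phom C i j) :
    phom D (ob i) (ob j) :=
  dclass (diagram_map F (repr c)).

Lemma phom_mapE (F : premorphism ob C D) i j (d : diagram C i j) :
  phom_map F (dclass d) = dclass (diagram_map F d).
Proof.
by apply/dclassP; apply: diagram_map_equiv; apply/dclassP; rewrite dreprK.
Qed.

Lemma phom_map_emb (F : premorphism ob C D) i j (f : hom C i j) :
  phom_map F (emb f) = emb (F _ _ f).
Proof.
rewrite phom_mapE; apply/dclassP; exists (idm D (ob i)).
by rewrite /= !compm1 pre_id; split=> //; apply: iso_id.
Qed.

End DiagramMap.

Coercion premorphism_of : Smorphism >-> premorphism.

Section PMor.
Context (O O' : Type) (ob : O -> O') (C : category O) (D : category O').
Context (pbC : PB C) (pbD : PB D) (F : premorphism ob C D).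
Local Notation PC := (partialization pbC).
Local Notation PD := (partialization pbD).
Let PF : hom_map ob PC PD := @phom_map O O' ob C D F.

Lemma PF_id i : PF (idm PC i) = idm PD (ob i).
Proof. by rewrite /PF /= phom_map_emb pre_id. Qed.

Lemma PF_isol i j k (g : hom PC j k) (f : hom PC i j) : iso g ->
  PF (g ** f) = PF g ** PF f.
Proof.
move=> ig'; have [g0 [ig eg]] := iso_embP ig'; subst g; have [l [a [ma [f0 ->]]]] := phomP f.
rewrite /PF /= phom_map_emb pcomp_embl !phom_mapE pcomp_embl.
by rewrite /diagram_map /= (pre_isol F g0 f0 ig).
Qed.

Lemma PF_isor i j k (g : hom PC j k) (f : hom PC i j) : iso f ->
  PF (g ** f) = PF g ** PF f.
Proof.
move=> if'; have [f0 [[f1 inv] ef]] := iso_embP if'; subst f; have [l [b [mb [g0 ->]]]] := phomP g.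
have i1 : iso f1 by exists f0; case: inv.
have m1 : mono (f1 ** b) by apply: mono_comp mb _; apply: iso_mono.
have invF : inverse (F _ _ f0) (F _ _ f1).
  case: inv => e1 e2; rewrite /inverse -!(pre_isol F) ?e1 ?e2 ?pre_id //.
  by exists f1.
have m2 : mono (F _ _ f1 ** F _ _ b).
  by rewrite -pre_isol //; apply: pre_mono.
rewrite (comp_emb_iso _ mb _ inv m1) /PF phom_map_emb !phom_mapE /diagram_map /=.
have /= -> := comp_emb_iso pbD (pre_mono F mb) (F _ _ g0) invF m2; apply/dclassP.
exists (idm D _); rewrite /= !compm1 pre_isol //; split=> //; exact: iso_id.
Qed.

Lemma PF_mono i j (f : hom PC i j) : mono f -> mono (PF f).
Proof.
move=> mf'; have [f0 [mf ef]] := mono_embP mf'; subst f; rewrite /PF phom_map_emb.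
by apply: emb_mono; apply: pre_mono.
Qed.

Definition P_pre : premorphism ob PC PD :=
  PreMorphism PF_id PF_isol PF_isor PF_mono.

End PMor.

Definition P_mor O O' (ob : O -> O') (C : Scat O) (D : Scat O')
    (F : premorphism ob C D) : premorphism ob (P_obj C) (P_obj D) :=
  P_pre (adm_PB (catP C)) (adm_PB (catP D)) F.

Fixpoint Pn_mor n O O' (ob : O -> O') (C : Scat O) (D : Scat O')
    (F : premorphism ob C D) : premorphism ob (Pn n C) (Pn n D) :=
  match n with 0 => F | S n => P_mor (Pn_mor n F) end.

(* The diagrams [i <- k_n <- ... <- k_1 -> j]; the outermost link carries [k_n]. *)
Fixpoint chain n O (C : category O) (i j : O) : Type :=
  match n with
  | 0 => hom C i j
  | S n => link C (fun k => chain n C k j) i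
  end.

(* Equivalence of two diagrams along an isomorphism [t] of their sources. *)
Fixpoint chain_equiv n O (C : category O) i i' j (t : hom C i i') :
    chain n C i j -> chain n C i' j -> Prop :=
  match n return chain n C i j -> chain n C i' j -> Prop with
  | 0 => fun f f' => f' ** t = f
  | S n => fun d d' => exists g : hom C (mid d) (mid d'),
      [/\ iso g, leg d' ** g = t ** leg d & chain_equiv g (rest d) (rest d')]
  end.

Fixpoint embn n O (C : Scat O) i j (f : hom C i j) : hom (Pn n C) i j :=
  match n with 0 => f | S n => emb (embn n f) end.

Section Dn.
Context (O : Type) (C : Scat O).

Lemma embn_mono n i j (f : hom C i j) : mono f -> mono (embn n f).
Proof. by move=> mf; elim: n => [|n IHn] //=; apply: emb_mono. Qed.

Lemma embn_inj n i j (f g : hom C i j) : embn n f = embn n g -> f = g.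
Proof. by elim: n => [|n IHn] //= e; apply/IHn/emb_inj. Qed.

Lemma embn_comp n i j k (g : hom C j k) (f : hom C i j) :
  embn n (g ** f) = embn n g ** embn n f.
Proof. by elim: n => [|n IHn] //; rewrite [LHS]/= IHn; apply: emb_comp. Qed.

Lemma embn_id n i : embn n (idm C i) = idm (Pn n C) i.
Proof. by elim: n => [|n IHn] //=; rewrite IHn. Qed.

Lemma embn_iso n i j (f : hom C i j) : iso f -> iso (embn n f).
Proof.
by move=> [g [e1 e2]]; exists (embn n g); split; rewrite -embn_comp (e1, e2) embn_id.
Qed.

Lemma mono_embnP n i j (c : hom (Pn n C) i j) :
  mono c -> exists f : hom C i j, mono f /\ c = embn n f.
Proof.
elim: n c => [|n IHn] c mc; first by exists c.
have [d [md ->]] := mono_embP mc.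
by have [f [mf ->]] := IHn d md; exists f.
Qed.

Lemma iso_embnP n i j (c : hom (Pn n C) i j) :
  iso c -> exists f : hom C i j, iso f /\ c = embn n f.
Proof.
elim: n c => [|n IHn] c ic; first by exists c.
have [d [id' ->]] := iso_embP ic.
by have [f [jf ->]] := IHn d id'; exists f.
Qed.

(* The class [D(n,i,j,k_r,alpha_r,f)]. *)
Fixpoint Dn n i j : chain n C i j -> hom (Pn n C) i j :=
  match n return chain n C i j -> hom (Pn n C) i j with
  | 0 => fun f => f
  | S n => fun d =>
      dclass (@Link O (Pn n C) (fun k => hom (Pn n C) k j) i (mid d)
        (embn n (leg d)) (@embn_mono n _ _ _ (legP d)) (@Dn n _ j (rest d)))
  end.

Lemma Dn_equiv_gen n i i' j (t : hom C i i') (d : chain n C i j)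
    (d' : chain n C i' j) : iso t ->
  Dn d' ** embn n t = Dn d <-> chain_equiv t d d'.
Proof.
elim: n i i' t d d' => [|n IHn] i i' t d d' it //=.
have [u [ut tu]] := it.
case: d d' => k a ma r [k' a' ma' r'] /=.
have inv : inverse (embn n t) (embn n u).
  by split; rewrite -embn_comp (ut, tu) embn_id.
have mu : mono (embn n u ** embn n a').
  by apply: mono_comp; apply: embn_mono => //; apply: iso_mono; exists t.
have /= -> := comp_emb_iso (adm_PB (catP (Pn n C))) (@embn_mono n _ _ _ ma')
  (Dn r') inv mu; split.
- move=> /esym/dclassP [h /= [/iso_embnP [g [ig ->]] e1 e2]].
  exists g; split=> //; last exact/IHn.
  have /embn_inj <- : embn n (u ** (a' ** g)) = embn n a.
    by rewrite !embn_comp compA.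
  by rewrite compA tu comp1m.
- move=> [g [ig e1 /(IHn _ _ _ _ _ ig) e2]].
  apply/esym/dclassP; exists (embn n g); split=> //=; first exact: embn_iso.
  by rewrite -!embn_comp -compA e1 compA ut comp1m.
Qed.

Lemma Dn_equiv n i j (d d' : chain n C i j) :
  Dn d = Dn d' <-> chain_equiv (idm C i) d d'.
Proof.
rewrite -(Dn_equiv_gen _ _ (@iso_id _ _ i)) embn_id compm1.
by split=> /esym.
Qed.

Lemma Dn_surj n i j (c : hom (Pn n C) i j) : exists d : chain n C i j, c = Dn d.
Proof.
elim: n i c => [|n IHn] i c; first by exists c.
have [k [a [ma [g ->]]]] := phomP c.
have [f [mf ef]] := mono_embnP ma; subst a; have [d ed] := IHn _ g.
exists (@Link _ _ (fun k => chain n C k j) _ _ f mf d); apply/dclassP => /=.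
exists (idm (Pn n C) k).
by rewrite /= !compm1 ed; split=> //; apply: iso_id.
Qed.

Definition Dn_repr n i j (c : hom (Pn n C) i j) : chain n C i j :=
  proj1_sig (constructive_indefinite_description _ (Dn_surj c)).

Lemma Dn_reprK n i j (c : hom (Pn n C) i j) : Dn (Dn_repr c) = c.
Proof. by rewrite /Dn_repr; case: constructive_indefinite_description => d /=. Qed.

End Dn.

Section Surgery.
Context (O : Type) (C : category O).

Definition cons_id n i j (d : chain n C i j) : chain (S n) C i j :=
  @Link _ _ (fun k => chain n C k j) _ _ (idm C i) (@mono_id _ _ i) d.

(* Doubles [k_s] in [i <- k_n <- ... <- k_1 -> j], where [k_(n+1) = i]. *)
Fixpoint double_at (s n : nat) i j : chain n C i j -> chain (S n) C i j :=
  match n return chain n C i j -> chain (S n) C i j with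
  | 0 => fun d => cons_id (n := 0) d
  | S m => fun d =>
      if Nat.eqb s (S (S m)) then cons_id (n := S m) d
      else @Link _ _ (fun k => chain (S m) C k j) _ _
             (leg d) (legP d) (double_at s (rest d))
  end.

(* Deletes [k_s] from [i <- k_n <- ... <- k_1 -> j] for [n = m + 2]; the case
   [m = 0] can only occur for [s = 2]. *)
Fixpoint delete_at (s m : nat) i j :
    chain (S (S m)) C i j -> chain (S m) C i j :=
  match m return chain (S (S m)) C i j -> chain (S m) C i j with
  | 0 => fun d =>
      @Link _ _ (fun k => chain 0 C k j) _ _ (leg d ** leg (rest d))
        (mono_comp (legP (rest d)) (legP d)) (rest (rest d))
  | S m' => fun d =>
      if Nat.eqb s (S (S (S m'))) then
        @Link _ _ (fun k => chain (S m') C k j) _ _ (leg d ** leg (rest d))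
          (mono_comp (legP (rest d)) (legP d)) (rest (rest d))
      else @Link _ _ (fun k => chain (S m') C k j) _ _
             (leg d) (legP d) (delete_at s (rest d))
  end.

Lemma double_at_equiv s n i i' j (t : hom C i i') (d : chain n C i j)
    (d' : chain n C i' j) : iso t ->
  chain_equiv t d d' -> chain_equiv t (double_at s d) (double_at s d').
Proof.
elim: n i i' t d d' => [|n IHn] i i' t d d' it.
  by move=> e; exists t; rewrite /= comp1m compm1.
rewrite /=; case: Nat.eqb => e.
  by exists t; rewrite /= comp1m compm1.
by case: e => g [ig e1 e2]; exists g; split=> //; apply: IHn.
Qed.

Lemma delete_at_equiv s m i i' j (t : hom C i i') (d : chain (S (S m)) C i j)
    (d' : chain (S (S m)) C i' j) : iso t ->
  chain_equiv t d d' -> chain_equiv t (delete_at s d) (delete_at s d').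
Proof.
elim: m i i' t d d' => [|m IHm] i i' t d d' it [g [ig e1]] /=.
  move=> [h [ih e2 e3]]; exists h.
  by rewrite /= -compA e2 !compA e1.
case: Nat.eqb => e; last by exists g; split=> //; apply: IHm.
move: e => /= [h [ih e2 e3]]; exists h.
by rewrite /= -compA e2 !compA e1.
Qed.

End Surgery.

(* The morphism maps of a family of functors [P^n(C) -> P^m(C)] which are the
   identity on objects. *)
Definition transformation (n m : nat) :=
  forall O (C : Scat O), hom_map id (Pn n C) (Pn m C).

Record natural_transformation n m (T : transformation n m) : Prop := {
  nt_component : forall O (C : Scat O), is_Smorphism (T O C);
  nt_natural : forall O O' (ob : O -> O') (C : Scat O) (D : Scat O')
      (F : Smorphism ob C D) i j (c : hom (Pn n C) i j),
    T O' D _ _ (Pn_mor n F _ _ c) = Pn_mor m F _ _ (T O C _ _ c)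
}.

Definition injective_transformation n m (T : transformation n m) :=
  forall O (C : Scat O) i j, Injective (@T O C i j).

Definition surjective_transformation n m (T : transformation n m) :=
  forall O (C : Scat O) i j, Surjective (@T O C i j).

Definition eq_transformation n m (T U : transformation n m) :=
  forall O (C : Scat O) i j (c : hom (Pn n C) i j), T O C i j c = U O C i j c.

Definition id_transformation n : transformation n n := fun O C i j c => c.

Arguments id_transformation : clear implicits.

Definition comp_transformation n m p (U : transformation m p)
    (T : transformation n m) : transformation n p :=
  fun O C i j c => U O C _ _ (T O C _ _ c).

Definition double (n s : nat) : transformation n (S n) :=
  fun O C i j c => Dn (double_at s (Dn_repr c)).

(* From [P^n] to [P^(n-1)], where [n = m + 2]. *)
Definition delete (m s : nat) : transformation (S (S m)) (S m) :=
  fun O C i j c => Dn (delete_at s (Dn_repr c)).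

Arguments double : clear implicits.
Arguments delete : clear implicits.

(* The values do not depend on the choice of a diagram in its class. *)
Lemma doubleE n s O (C : Scat O) i j (d : chain n C i j) :
  double n s O C i j (Dn d) = Dn (double_at s d).
Proof.
apply/Dn_equiv/double_at_equiv; first exact: iso_id.
by apply/Dn_equiv; rewrite Dn_reprK.
Qed.

Lemma deleteE m s O (C : Scat O) i j (d : chain (S (S m)) C i j) :
  delete m s O C i j (Dn d) = Dn (delete_at s d).
Proof.
apply/Dn_equiv/delete_at_equiv; first exact: iso_id.
by apply/Dn_equiv; rewrite Dn_reprK.
Qed.

(* Main.v *)
Require Import Defs.
From Stdlib Require Import ProofIrrelevance Lia.

(** On diagrams, all the assertions except functoriality are bookkeeping.
    Doubling an object and then deleting one of the two copies gives back the
    same chain of arrows, and surgeries at distant places commute; these are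
    equalities of chains, hence of their classes.  They exhibit each doubling
    as a section of a deletion and each deletion as a retraction of a doubling,
    which gives injectivity and surjectivity.  Naturality holds because a functor
    preserves the identities and composites that the surgeries introduce.

    The substance is that doubling and deleting respect composition.  At the
    outer end of the chain, doubling is the embedding of a category X in P(X),
    while deleting is the flattening P(P(X)) -> P(X) which composes the two
    legs.  Elsewhere, the surgery on P^(n+1)(C) is P applied to the same surgery
    on P^n(C).  So induction on n works if P(F) is a functor whenever F is one
    of the surgeries, which is not automatic: composition in P(X) uses pullbacks
    along monomorphisms, and F has to preserve them.

    The property of F that passes to P(F) involves one more limit-like
    construction.  Condition (CD), in the form which holds for all iterated
    partializations ([admissibleP]), says that X has final pullback complements:
    the terminal ways of completing monomorphisms i -> j -> k to a pullback
    square over j -> k.  A pullback in P(X) along a monomorphism consists of a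
    pullback in X and of a final pullback complement in X
    ([partial_pullback]), and a final pullback complement in P(X) is one of X
    ([emb_final_pullback_complement]).  Therefore, if F preserves monomorphisms,
    pullbacks along them and final pullback complements, then so does P(F)
    ([partializable_lift]).  The embedding has this property
    ([partializable_emb]).  So does the flattening ([partializable_flatten]),
    because final pullback complements compose
    ([final_pullback_complement_comp]). *)

Set Implicit Arguments.
Unset Strict Implicit.
Unset Printing Implicit Defensive.

(** * Final pullback complements *)

Section FinalPullbackComplements.
Context (O : Type) (C : category O).

(** The conclusion of (CD) in the form which closure under partialization gives:
    [x] and [z] in the universal property are arbitrary. *)
Definition final_pullback_complement i j k l (a : hom C i j) (b : hom C j k)
    (c : hom C i l) (d : hom C l k) :=
  [/\ mono d, is_pullback b d a c &
    forall m n (x : hom C m i) (y : hom C m n) (z : hom C n k),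
      is_pullback b z (a ** x) y ->
      exists u : hom C n l, d ** u = z /\ u ** y = c ** x].

Lemma final_pullback_complement_exists i j k (a : hom C i j) (b : hom C j k) :
  CD_all C -> mono a -> mono b ->
  exists l (c : hom C i l) (d : hom C l k), final_pullback_complement a b c d.
Proof.
by move=> cd ma mb; have [l [c [d [_ md cd' U]]]] := cd _ _ _ _ _ ma mb; exists l, c, d.
Qed.

Lemma final_pullback_complement_mono i j k l (a : hom C i j) (b : hom C j k)
    (c : hom C i l) (d : hom C l k) :
  mono b -> final_pullback_complement a b c d -> mono c.
Proof. by move=> mb [_ pbq _]; apply: pullback_mono (pullback_sym pbq) mb. Qed.

(** The converse of pasting: if a rectangle and its right-hand square are
    pullbacks, so is the left-hand square.  Its upper side [v] is the arrow which
    the right-hand square induces from the rectangle. *)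
Lemma pullback_cancel i j k l n o (a : hom C j k) (b : hom C i j)
    (z : hom C n k) (x' : hom C o j) (y' : hom C o n)
    (x : hom C l i) (y : hom C l n) : mono a ->
  is_pullback a z x' y' -> is_pullback (a ** b) z x y ->
  exists v : hom C l o, y' ** v = y /\ is_pullback b x' x v.
Proof.
move=> ma pb1 [e U].
have my' := pullback_mono (pullback_sym pb1) ma; have [e1 U1] := pb1.
have [|v [[v1 v2] _]] := U1 l (b ** x) y; first by rewrite compA.
exists v; split=> //; split=> [|m s t est]; first by rewrite v1.
have [|w [[w1 w2] uw]] := U m s (y' ** t).
  by rewrite -compA est !compA e1.
exists w; split; first by split=> //; apply: my'; rewrite compA v2 w2.
by move=> w' [w'1 w'2]; apply: uw; rewrite -v2 -compA w'2.
Qed.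

(** Each complement is terminal, so the universal properties give arrows both
    ways; [d] and [d'] being monomorphisms, these are mutually inverse. *)
Lemma final_pullback_complement_unique i j k l l' (a : hom C i j) (b : hom C j k)
    (c : hom C i l) (d : hom C l k) (c' : hom C i l') (d' : hom C l' k) :
  final_pullback_complement a b c d -> final_pullback_complement a b c' d' ->
  exists u : hom C l l', [/\ iso u, d' ** u = d & u ** c = c'].
Proof.
move=> [md cd U] [md' cd' U'].
have [|u [u1 u2]] := U' _ _ (idm C i) c d; first by rewrite compm1.
have [|v [v1 v2]] := U _ _ (idm C i) c' d'; first by rewrite compm1.
exists u; rewrite u2 compm1; split=> //; exists v; split.
- by apply: md; rewrite compA v1 u1 compm1.
- by apply: md'; rewrite compA u1 v1 compm1.
Qed.

Lemma final_pullback_complement_iso i j k l l' (a : hom C i j) (b : hom C j k)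
    (c : hom C i l) (d : hom C l k) (u : hom C l l')
    (c' : hom C i l') (d' : hom C l' k) : iso u -> d' ** u = d -> u ** c = c' ->
  final_pullback_complement a b c' d' -> final_pullback_complement a b c d.
Proof.
move=> iu <- <- [md' cd' U]; have [v [vu uv]] := iu; split.
- exact: mono_comp (iso_mono iu) md'.
- have := pullback_iso cd' (iso_id C j) (ex_intro _ u (conj uv vu))
    (f' := b) (a' := d' ** u).
  by rewrite compm1 -compA uv compm1 compA vu !comp1m; apply.
- move=> m n x y z /U [w [<- ew]]; exists (v ** w); split.
    by rewrite -compA (compA u) uv comp1m.
  by rewrite -compA ew !compA vu comp1m.
Qed.

(** A competitor [z] of the composite is pulled back along [a] first.  What
    remains over [b] is a competitor of the first complement, and the arrow it
    induces makes [z] a competitor of the second one. *)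
Lemma final_pullback_complement_comp i j k l r r' (p : hom C i j)
    (b : hom C j k) (a : hom C k l) (c : hom C i r) (d : hom C r k)
    (c' : hom C r r') (d' : hom C r' l) : PB C -> mono a ->
  final_pullback_complement p b c d -> final_pullback_complement d a c' d' ->
  final_pullback_complement p (a ** b) (c' ** c) d'.
Proof.
move=> pb ma [md cd U] [md' cd' U']; split=> //; first exact: pullback_paste cd' cd.
move=> m n x y z xyz.
have [o [y' [x' zpb]]] := pb _ _ _ z a ma; have pbz := pullback_sym zpb.
have [v [<- pbv]] := pullback_cancel ma pbz xyz.
have [w [ew1 ew2]] := U _ _ _ _ _ pbv.
rewrite -ew1 in pbz; have [u [eu1 eu2]] := U' _ _ _ _ _ pbz.
by exists u; split=> //; rewrite compA eu2 -!compA ew2.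
Qed.

End FinalPullbackComplements.

(** * Pullbacks and final pullback complements in the partialization *)

Section PartializationLimits.
Context (O : Type) (C : category O) (pb : PB C).
Local Notation P := (partialization pb).
Local Notation Emb f := (emb f : hom P _ _).
Local Notation D a ma f := (dclass (Link a ma f) : hom P _ _).

(** Pulling back the monomorphism [b] along the partial map [D a ma f] asks for
    the pullback [p] of [b] along [f], then for the largest subobject [d] of [i]
    which meets [k] in [p]: this is the final pullback complement. *)
Lemma partial_pullback i j k n l0 l (a : hom C k i) (ma : mono a) (f : hom C k j)
    (b : hom C n j) (p : hom C l0 k) (q : hom C l0 n)
    (g : hom C l0 l) (mg : mono g) (d : hom C l i) : mono b ->
  is_pullback f b p q -> final_pullback_complement p a g d ->
  is_pullback (D a ma f) (Emb b) (Emb d) (D g mg q).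
Proof.
move=> mb pq [md gd U]; have mp := pullback_mono pq mb.
split.
  by rewrite /= (pcomp_embr pb ma f mg (pullback_sym gd)) pcomp_embl pq.1.
move=> m x y; have [q0 [u [mu [x0 ->]]]] := phomP x.
have [r [v [mv [y0 ->]]]] := phomP y.
have [s [t [sg st]]] := pb x0 ma; have mt := pullback_mono st ma.
have mus := mono_comp mt mu.
rewrite /= (pcompE _ mu ma f mus st) pcomp_embl => /dclassP [e /= [ie e1 e2]].
have [|h [[h1 h2] _]] := pq.2 s sg (y0 ** e); first by rewrite compA e2.
have [w [w1 w2]] : exists w, d ** w = x0 /\ w ** t = g ** h.
  by apply: U; rewrite h1; apply: pullback_sym.
(* [w] lifts [x0] through [d], so its pullback along [g] is read off from that
   of [x0] along [a] by cancelling the square of the complement. *)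
have wg : is_pullback w g t h.
  have dst : is_pullback (d ** w) a t (p ** h) by rewrite w1 h1.
  have [h' [eh wh]] := pullback_cancel md (pullback_sym gd) dst.
  by rewrite -(mp _ _ _ eh).
exists (D u mu w); split; last first.
  move=> z [z1 _]; apply: (@emb_mono _ _ pb _ _ _ md m).
  by rewrite /= z1 pcomp_embl w1.
rewrite /= pcomp_embl w1; split=> //.
by rewrite (pcompE _ mu mg q mus wg); apply/dclassP; exists e.
Qed.

(** A partial map whose composite with an embedded monomorphism is everywhere
    defined is itself everywhere defined ([emb_factor]), so universal arrows of the
    partialization come from the base category. *)
Lemma emb_reflect_pullback i j k l (f : hom C i j) (a : hom C k j)
    (p : hom C l i) (q : hom C l k) : mono p ->
  is_pullback (Emb f) (Emb a) (Emb p) (Emb q) -> is_pullback f a p q.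
Proof.
move=> mp [e U]; split; first by apply: (@emb_inj _ C); move: e; rewrite -!emb_comp.
move=> m x y exy; have [|w [[w1 w2] _]] := U m (Emb x) (Emb y).
  by rewrite -!emb_comp exy.
have [h eh hx] := emb_factor w1; exists h; split; last first.
  by move=> h' [h'x _]; apply: mp; rewrite hx h'x.
split=> //; apply: (@emb_inj _ C).
by change (Emb (q ** h) = Emb y); rewrite emb_comp -eh.
Qed.

(** The partialization has a complement of the embedded pair, and its arrows are
    monomorphisms, hence embedded.  The universal property descends by
    [emb_factor], so this complement is the given one, up to isomorphism. *)
Lemma emb_final_pullback_complement i j k l (a : hom C i j) (b : hom C j k)
    (c : hom C i l) (d : hom C l k) : CD_all C -> mono a -> mono b ->
  final_pullback_complement a b c d ->
  final_pullback_complement (Emb a) (Emb b) (Emb c) (Emb d).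
Proof.
move=> cd ma mb H.
have [l' [c0 [d0 [mc0 md0 cd0 U]]]] :=
  CD_all_P (pb := pb) cd (emb_mono (pb := pb) ma) (emb_mono (pb := pb) mb).
have [c' [mc' ec]] := mono_embP mc0; have [d' [md' ed]] := mono_embP md0; subst c0 d0.
have H' : final_pullback_complement a b c' d'.
  split=> //; first exact: emb_reflect_pullback.
  move=> m n x y z xyz; have [|u [eu1 eu2]] := U m n (Emb x) (Emb y) (Emb z).
    by rewrite -emb_comp; apply/pullback_sym/emb_pullback => //; exact: pullback_sym.
  have [h eh hz] := emb_factor eu1; exists h; split=> //; apply: (@emb_inj _ C).
  by change (Emb (h ** y) = Emb (c' ** x)); rewrite !emb_comp -eh.
have [u [iu u1 u2]] := final_pullback_complement_unique H H'.
apply: (@final_pullback_complement_iso _ P _ _ _ _ _ _ _ _ _ (Emb u) (Emb c') (Emb d')).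
- exact: emb_iso.
- by rewrite -emb_comp u1.
- by rewrite -emb_comp u2.
- by split.
Qed.

End PartializationLimits.

(** * Functors whose partialization is a functor *)

(** One preserved instance for each pair of arrows is enough, since pullbacks and
    final pullback complements are unique up to isomorphism; this form is also
    what composition in the partialization needs. *)
Record partializable O O' (ob : O -> O') (C : category O) (D : category O')
    (F : hom_map ob C D) : Prop := Partializable {
  partializable_Smorphism :> is_Smorphism F;
  partializable_pullback : forall i j k (f : hom C i j) (a : hom C k j), mono a ->
    exists l (p : hom C l i) (q : hom C l k),
      is_pullback f a p q /\
      is_pullback (F _ _ f) (F _ _ a) (F _ _ p) (F _ _ q);
  partializable_complement : forall i j k (a : hom C i j) (b : hom C j k),
    mono a -> mono b ->
    exists l (c : hom C i l) (d : hom C l k),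
      final_pullback_complement a b c d /\
      final_pullback_complement (F _ _ a) (F _ _ b) (F _ _ c) (F _ _ d)
}.

(** Functors are described by their values on arrows, here and in the lemmas on
    lifting and flattening, so that each applies to any map of hom-sets that
    agrees with the construction. *)
Lemma partializable_emb O (C : category O) (pb : PB C) (cd : CD_all C)
    (G : hom_map id C (partialization pb)) :
  (forall i j (f : hom C i j), G i j f = emb f) -> partializable G.
Proof.
move=> GE; split; first split=> [i|i j k g f|i j f mf]; rewrite ?GE //.
- by rewrite (emb_comp pb).
- exact: emb_mono.
- move=> i j k f a ma; have [l [p [q pq]]] := pb _ _ _ f a ma.
  by exists l, p, q; rewrite !GE; split=> //; apply: emb_pullback.
- move=> i j k a b ma mb.
  have [l [c [d H]]] := final_pullback_complement_exists cd ma mb.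
  exists l, c, d; rewrite !GE; split=> //.
  exact: emb_final_pullback_complement.
Qed.

Section Lift.
Context (O O' : Type) (ob : O -> O') (C : category O) (D : category O').
Context (pbC : PB C) (pbD : PB D).
Local Notation PC := (partialization pbC).
Local Notation PD := (partialization pbD).

(** [G] is the partialization of [F].  It respects composition because [F]
    preserves pullbacks along monomorphisms.  Preservation of such pullbacks by
    [G] needs both preservation properties of [F], by the construction of
    [partial_pullback]. *)
Lemma partializable_lift (cdC : CD_all C) (cdD : CD_all D) (F : hom_map ob C D)
    (G : hom_map ob PC PD) :
  partializable F ->
  (forall i j k (a : hom C k i) (ma : mono a) (mFa : mono (F _ _ a)) (f : hom C k j),
    G i j (dclass (Link a ma f)) = dclass (Link (F _ _ a) mFa (F _ _ f))) ->
  partializable G.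
Proof.
move=> [SF Fpb Ffpc] GE.
have GEmb i j (f : hom C i j) : G _ _ (emb f) = emb (F _ _ f).
  have mF : mono (F _ _ (idm C i)) by apply: Smor_mono SF _ _ _ _; exact: mono_id.
  rewrite /emb (GE _ _ _ _ _ mF); apply/dclassP; exists (idm D _).
  by rewrite /= !compm1 (Smor_id SF); split=> //; apply: iso_id.
split; first split.
- by move=> i; rewrite /= GEmb (Smor_id SF).
- move=> i j k g f.
  have [x [a [ma [f0 ->]]]] := phomP f; have [y [b [mb [g0 ->]]]] := phomP g.
  have [l [p [q [pq Fpq]]]] := Fpb _ _ _ f0 b mb.
  have map := mono_comp (pullback_mono pq mb) ma.
  have mFa := Smor_mono SF ma; have mFb := Smor_mono SF mb.
  have mFap := Smor_mono SF map.
  have mFap' := mFap; rewrite (Smor_comp SF) in mFap'.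
  rewrite /= (pcompE pbC ma mb g0 map pq) (GE _ _ _ _ _ mFap) (GE _ _ _ _ _ mFa).
  rewrite (GE _ _ _ _ _ mFb) (pcompE pbD mFa mFb _ mFap' Fpq).
  apply/dclassP; exists (idm D _); rewrite /= !compm1 !(Smor_comp SF).
  by split=> //; apply: iso_id.
- move=> i j c mc; have [f [mf ->]] := mono_embP mc; rewrite GEmb; apply: emb_mono.
  exact: Smor_mono SF _ _ _ mf.
- move=> i j k c b' mb'; have [b [mb ->]] := mono_embP mb'.
  have [x [a [ma [f ->]]]] := phomP c.
  have [l0 [p [q [pq Fpq]]]] := Fpb _ _ _ f b mb; have mp := pullback_mono pq mb.
  have [l [g [d [H FH]]]] := Ffpc _ _ _ p a mp ma.
  have mg := final_pullback_complement_mono ma H.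
  have mFa := Smor_mono SF ma; have mFg := Smor_mono SF mg.
  exists l, (emb d), (dclass (Link g mg q)); split.
    exact: partial_pullback mb pq H.
  rewrite !GEmb (GE _ _ _ _ _ mFa) (GE _ _ _ _ _ mFg).
  by apply: partial_pullback Fpq FH; apply: Smor_mono SF _ _ _ mb.
- move=> i j k a' b' ma' mb'.
  have [a [ma ->]] := mono_embP ma'; have [b [mb ->]] := mono_embP mb'.
  have [l [c [d [H FH]]]] := Ffpc _ _ _ a b ma mb.
  have mFa := Smor_mono SF ma; have mFb := Smor_mono SF mb.
  exists l, (emb c), (emb d); rewrite !GEmb.
  by split; apply: emb_final_pullback_complement.
Qed.

End Lift.

Section Flatten.
Context (O : Type) (C : category O) (pb : PB C).
Local Notation P := (partialization pb).
Context (pbP : PB P).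
Local Notation PP := (partialization pbP).
Local Notation D a ma f := (dclass (Link a ma f) : hom P _ _).
Local Notation DP a ma f :=
  (@dclass _ P _ _ (@Link _ P (fun k => hom P k _) _ _ (emb a) ma f) : hom PP _ _).

Lemma partial_partialP i j (c : hom PP i j) :
  exists k l (a : hom C k i) (ma : mono a) (mea : mono (emb a : hom P k i))
    (b : hom C l k) (mb : mono b) (f : hom C l j), c = DP a mea (D b mb f).
Proof.
have [k [a' [mea [g ->]]]] := phomP c.
have [a [ma ea]] := mono_embP mea; subst a'.
have [l [b [mb [f ->]]]] := phomP g.
by exists k, l, a, ma, mea, b, mb, f.
Qed.

(** In a composite of two nested diagrams the outer legs are reached through a
    final pullback complement [d], [g]; in the composite of the flattened diagrams
    a pasted pullback is used instead.  The two agree since the square of the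
    complement commutes.  For pullbacks, the nested diagram gives two successive
    complements, and flattening composes them. *)
Lemma partializable_flatten (cd : CD_all C) (G : hom_map id PP P) :
  (forall i j k l (a : hom C k i) (mea : mono (emb a : hom P k i))
     (b : hom C l k) (mb : mono b) (mab : mono (a ** b)) (f : hom C l j),
    G i j (DP a mea (D b mb f)) = D (a ** b) mab f) ->
  partializable G.
Proof.
move=> GE.
(* Flattening undoes the embedding; in particular it preserves everything that
   lies in the image of the embedding. *)
have GEmb i j (c : hom P i j) : G i j (emb c) = c.
  have [l [b [mb [f ->]]]] := phomP c.
  have m1b : mono (idm C i ** b) by rewrite comp1m.
  rewrite (GE _ _ _ _ (idm C i) _ b mb m1b f); apply/dclassP; exists (idm C l).
  by rewrite /= !compm1 comp1m; split=> //; apply: iso_id.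
have cdP := CD_all_P (pb := pb) cd.
split; first split.
- by move=> i; exact: GEmb.
- move=> i j o c' c.
  have [k [l [a [ma [mea [b [mb [f ->]]]]]]]] := partial_partialP c.
  have [k' [l' [a' [ma' [mea' [b' [mb' [f' ->]]]]]]]] := partial_partialP c'.
  have [l0 [p [q pq]]] := pb f ma'; have mp := pullback_mono pq ma'.
  have [r [g [d H]]] := final_pullback_complement_exists cd mp mb.
  have [md gd _] := H; have mg := final_pullback_complement_mono mb H.
  have [w [p2 [q2 pq2]]] := pb q mb'; have mp2 := pullback_mono pq2 mb'.
  have mgp2 := mono_comp mp2 mg; have mad := mono_comp md ma.
  have mab := mono_comp mb ma; have mab' := mono_comp mb' ma'.
  have mabp := mono_comp (mono_comp mp2 mp) mab.
  have mead := emb_mono (pb := pb) mad.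
  have mead' := mead; rewrite emb_comp in mead'.
  have madgp := mono_comp mgp2 mad.
  have -> : (DP a' mea' (D b' mb' f') : hom PP j o) ** DP a mea (D b mb f)
      = DP (a ** d) mead (D (g ** p2) mgp2 (f' ** q2)).
    rewrite /= (pcompE pbP mea mea' _ mead' (partial_pullback pb mb mg ma' pq H)).
    rewrite /= (pcompE pb mg mb' f' mgp2 pq2).
    apply/dclassP; exists (idm P r); rewrite !compm1; split=> //.
      exact: iso_id.
    exact: (emb_comp pb).
  rewrite (GE _ _ _ _ _ _ _ _ madgp) (GE _ _ _ _ _ _ _ _ mab) (GE _ _ _ _ _ _ _ _ mab').
  have pqq : is_pullback f (a' ** b') (p ** p2) q2.
    exact/pullback_sym/(pullback_paste (pullback_sym pq) (pullback_sym pq2)).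
  rewrite /= (pcompE pb mab mab' f' mabp pqq).
  apply/dclassP; exists (idm C w); rewrite /= !compm1; split=> //.
    exact: iso_id.
  by rewrite !compA -(compA a d) -gd.1 !compA.
- by move=> i j c mc; have [c0 [mc0 ->]] := mono_embP mc; rewrite GEmb.
- move=> i j n c h'' mh''.
  have [h' [mh' ->]] := mono_embP mh''; have [h [mh eh]] := mono_embP mh'; subst h'.
  have [k [l [a [ma [mea [b [mb [f ->]]]]]]]] := partial_partialP c.
  have [l0 [p [q pq]]] := pb f mh; have mp := pullback_mono pq mh.
  have [r [g [d H]]] := final_pullback_complement_exists cd mp mb.
  have [md _ _] := H; have mg := final_pullback_complement_mono mb H.
  (* The complement of [d] along the outer leg [a], on top of the complement [d]
     of [p] along the inner leg [b]. *)
  have [r' [g' [d' H']]] := final_pullback_complement_exists cd md ma.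
  have [md' _ _] := H'; have mg' := final_pullback_complement_mono ma H'.
  have mab := mono_comp mb ma; have mgg := mono_comp mg mg'.
  have meg' := emb_mono (pb := pb) mg'.
  exists r', (emb (emb d' : hom P _ _)), (DP g' meg' (D g mg q)); split.
    apply: (partial_pullback pbP mea meg' mh' (partial_pullback pb mb mg mh pq H)).
    exact: emb_final_pullback_complement.
  rewrite !GEmb (GE _ _ _ _ _ _ _ _ mab) (GE _ _ _ _ _ _ _ _ mgg).
  by apply: partial_pullback pq _ => //; apply: final_pullback_complement_comp H H'.
- move=> i j k a' b' ma' mb'.
  have [a [ma ->]] := mono_embP ma'; have [b [mb ->]] := mono_embP mb'.
  have [l [c [d H]]] := final_pullback_complement_exists cdP ma mb.
  exists l, (emb c), (emb d); rewrite !GEmb; split=> //.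
  exact: emb_final_pullback_complement.
Qed.

End Flatten.

(** * Surgery on chains *)

Section Chains.
Context (O : Type) (C : category O).

(** Proofs that a leg is a monomorphism are irrelevant. *)
Lemma link_eq (T : O -> Type) i k (a a' : hom C k i) (ma : mono a)
    (ma' : mono a') (r : T k) :
  a = a' -> @Link O C T i k a ma r = Link a' ma' r.
Proof. by move=> e; subst a'; rewrite (proof_irrelevance _ ma ma'). Qed.

Definition chain_link n i j k (a : hom C k i) (ma : mono a) (r : chain n C k j) :
    chain (S n) C i j :=
  @Link O C (fun k => chain n C k j) i k a ma r.

Lemma chainP n i j (d : chain (S n) C i j) :
  exists k (a : hom C k i) (ma : mono a) (r : chain n C k j), d = chain_link ma r.
Proof. by case: d => k a ma r; exists k, a, ma, r. Qed.

Lemma double_at_top n i j (d : chain n C i j) : double_at (S n) d = cons_id d.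
Proof. by case: n d => [|n] d //=; rewrite Nat.eqb_refl. Qed.

Lemma double_at_rest s n i j k (a : hom C k i) (ma : mono a) (r : chain n C k j) :
  s < S (S n) -> double_at s (chain_link ma r) = chain_link ma (double_at s r).
Proof. by move=> hs /=; case: Nat.eqb_spec => // e; lia. Qed.

Lemma delete_at_top m i j k l (a : hom C k i) (ma : mono a) (b : hom C l k)
    (mb : mono b) (r : chain m C l j) :
  delete_at (S (S m)) (chain_link ma (chain_link mb r))
    = chain_link (mono_comp mb ma) r.
Proof. by case: m r => [|m] r //=; rewrite Nat.eqb_refl. Qed.

Lemma delete_at_rest s m i j k (a : hom C k i) (ma : mono a)
    (r : chain (S (S m)) C k j) : s < S (S (S m)) ->
  delete_at s (chain_link ma r) = chain_link ma (delete_at s r).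
Proof. by move=> hs /=; case: Nat.eqb_spec => // e; lia. Qed.

Lemma delete_at_cons_id m i j (d : chain (S m) C i j) :
  delete_at (S (S m)) (cons_id d) = d.
Proof.
have [k [a [ma [r ->]]]] := chainP d.
by rewrite [LHS]delete_at_top; apply: link_eq; rewrite comp1m.
Qed.

Lemma delete_at_link_cons_id m i j k (a : hom C k i) (ma : mono a)
    (r : chain m C k j) :
  delete_at (S (S m)) (chain_link ma (cons_id r)) = chain_link ma r.
Proof. by rewrite [LHS]delete_at_top; apply: link_eq; rewrite compm1. Qed.

Lemma delete_at_double_at m s i j (d : chain (S m) C i j) : 2 <= s <= S (S m) ->
  delete_at s (double_at s d) = d.
Proof.
elim: m i d => [|m IHm] i d hs.
  have -> : s = 2 by lia.
  by rewrite double_at_top delete_at_cons_id.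
have [es | ns] := Nat.eq_dec s (S (S (S m))).
  by subst s; rewrite double_at_top delete_at_cons_id.
have [k [a [ma [r ->]]]] := chainP d.
by rewrite double_at_rest ?delete_at_rest ?IHm //; lia.
Qed.

Lemma delete_at_S_double_at m s i j (d : chain (S m) C i j) : 1 <= s <= S m ->
  delete_at (S s) (double_at s d) = d.
Proof.
elim: m i d => [|m IHm] i d hs; have [k [a [ma [r ->]]]] := chainP d.
  have -> : s = 1 by lia.
  by rewrite double_at_rest ?double_at_top ?delete_at_link_cons_id //; lia.
have [es | ns] := Nat.eq_dec s (S (S m)).
  by subst s; rewrite double_at_rest ?double_at_top ?delete_at_link_cons_id //; lia.
by rewrite double_at_rest ?delete_at_rest ?IHm //; lia.
Qed.

(** If a deletion takes place further out than a doubling, removing links from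
    the outer end of the chain reduces their commutation to this case. *)
Lemma delete_at_top_double_at m s i j (d : chain (S (S m)) C i j) :
  s < S (S m) ->
  delete_at (S (S (S m))) (double_at s d) = double_at s (delete_at (S (S m)) d).
Proof.
move=> hs; have [k [a [ma [c ->]]]] := chainP d; have [l [b [mb [c' ->]]]] := chainP c.
rewrite !double_at_rest ?delete_at_top; try lia.
by rewrite double_at_rest //; lia.
Qed.

Lemma delete_at_above_double_at m r s i j (d : chain (S (S m)) C i j) :
  1 <= s -> S s < r <= S (S (S m)) ->
  delete_at r (double_at s d) = double_at s (delete_at (r - 1) d).
Proof.
elim: m i d => [|m IHm] i d hs hr.
  have -> : r = 3 by lia.
  by apply: delete_at_top_double_at; lia.
have [er | nr] := Nat.eq_dec r (S (S (S (S m)))).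
  by subst r; apply: delete_at_top_double_at; lia.
have [k [a [ma [c ->]]]] := chainP d.
by rewrite double_at_rest ?delete_at_rest ?double_at_rest ?IHm //; lia.
Qed.

Lemma delete_at_below_double_at m r s i j (d : chain (S (S m)) C i j) :
  2 <= r < s -> s <= S (S (S m)) ->
  delete_at r (double_at s d) = double_at (s - 1) (delete_at r d).
Proof.
elim: m i d => [|m IHm] i d hr hs.
  have [-> ->] : r = 2 /\ s = 3 by lia.
  by rewrite !double_at_top [LHS]delete_at_rest.
have [-> | ns] := Nat.eq_dec s (S (S (S (S m)))).
  by rewrite !double_at_top [LHS]delete_at_rest //; lia.
have [k [a [ma [c ->]]]] := chainP d.
by rewrite double_at_rest ?delete_at_rest ?double_at_rest ?IHm //; lia.
Qed.

End Chains.

(** * Functoriality of doubling and deleting *)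

Section Transformations.
Context (O : Type) (C : Scat O).

Lemma Pn_CD_all n : CD_all (Pn n C).
Proof. exact: proj2 (proj1 (admissibleP _) (catP (Pn n C))). Qed.

Lemma Dn_chain_link n i j k (a : hom C k i) (ma : mono a)
    (mea : mono (embn n a)) (r : chain n C k j) :
  Dn (chain_link ma r) = dclass (Link (embn n a) mea (Dn r)).
Proof. by congr dclass; apply: link_eq. Qed.

Lemma Dn_cons_id n i j (d : chain n C i j) : Dn (cons_id d) = emb (Dn d).
Proof. by congr dclass; apply: link_eq; apply: embn_id. Qed.

Lemma double_top n i j (c : hom (Pn n C) i j) : double n (S n) O C i j c = emb c.
Proof. by rewrite -(Dn_reprK c) doubleE double_at_top Dn_cons_id. Qed.

(** Embedded arrows correspond to chains of identities, which doubling turns into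
    longer ones.  This identifies the legs of a diagram with their images in
    [double_rest]. *)
Lemma double_embn n s i j (f : hom C i j) : 1 <= s <= S n ->
  double n s O C i j (embn n f) = embn (S n) f.
Proof.
elim: n => [|n IHn] hs.
  have -> : s = 1 by lia.
  exact: double_top.
have [-> | ns] := Nat.eq_dec s (S (S n)); first exact: double_top.
rewrite [embn (S n) f]/= -(Dn_reprK (embn n f)) -Dn_cons_id doubleE.
rewrite [double_at _ _]double_at_rest; first by lia.
by rewrite [LHS]Dn_cons_id -doubleE Dn_reprK IHn //; lia.
Qed.

(** Away from the outer end, doubling is the partialization of the doubling one
    level below. *)
Lemma double_rest n s i j k (a : hom (Pn n C) k i) (ma : mono a)
    (mFa : mono (double n s O C k i a)) (c : hom (Pn n C) k j) : 1 <= s <= S n ->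
  double (S n) s O C i j (dclass (Link a ma c))
    = dclass (Link (double n s O C k i a) mFa (double n s O C k j c)).
Proof.
move=> hs; have [a0 [ma0 ea]] := mono_embnP ma; subst a.
rewrite -(Dn_reprK c) doubleE -(Dn_chain_link ma0) doubleE double_at_rest; first by lia.
have mea := embn_mono (n := S n) ma0.
rewrite (Dn_chain_link ma0 mea); congr dclass; apply: link_eq.
by rewrite double_embn.
Qed.

Lemma partializable_double n s : 1 <= s <= S n -> partializable (double n s O C).
Proof.
elim: n => [|n IHn] hs.
  have -> : s = 1 by lia.
  by apply: (@partializable_emb _ _ (adm_PB (catP (Pn 0 C)))
    (Pn_CD_all (n := 0))) => i j f;
    apply: (double_top (n := 0)).
have [-> | ns] := Nat.eq_dec s (S (S n)).
  by apply: (@partializable_emb _ _ (adm_PB (catP (Pn (S n) C)))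
    (Pn_CD_all (n := S n))) => i j f;
    apply: (double_top (n := S n)).
apply: (@partializable_lift _ _ id _ _ (adm_PB (catP (Pn n C)))
    (adm_PB (catP (Pn (S n) C)))
    (Pn_CD_all (n := n)) (Pn_CD_all (n := S n)) (double n s O C)).
  by apply: IHn; lia.
by move=> *; apply: double_rest; lia.
Qed.

Lemma delete_double m s i j (c : hom (Pn (S m) C) i j) : 2 <= s <= S (S m) ->
  delete m s O C i j (double (S m) s O C i j c) = c.
Proof.
by move=> hs; rewrite -(Dn_reprK c) doubleE deleteE delete_at_double_at.
Qed.

(** An embedded arrow is the double of an embedded arrow, which deleting
    recovers. *)
Lemma delete_embn m s i j (f : hom C i j) : 2 <= s <= S (S m) ->
  delete m s O C i j (embn (S (S m)) f) = embn (S m) f.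
Proof.
move=> hs; rewrite -(@double_embn (S m) s); first by lia.
exact: delete_double.
Qed.

Lemma delete_top m i j k l (a : hom (Pn m C) k i)
    (mea : mono (emb a : hom (Pn (S m) C) k i)) (b : hom (Pn m C) l k) (mb : mono b)
    (mab : mono (a ** b)) (f : hom (Pn m C) l j) :
  delete m (S (S m)) O C i j
    (dclass (@Link _ (Pn (S m) C) (fun k => hom (Pn (S m) C) k j) _ _
       (emb a) mea (dclass (Link b mb f))))
  = dclass (Link (a ** b) mab f).
Proof.
have [a0 [ma0 eea]] := mono_embnP mea; have [b0 [mb0 eb]] := mono_embnP mb.
have ea : a = embn m a0 := emb_inj eea; subst a b.
rewrite -(Dn_reprK f) -(Dn_chain_link mb0) -(Dn_chain_link (n := S m) ma0).
rewrite deleteE delete_at_top.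
have mab' : mono (embn m (a0 ** b0)) by rewrite embn_comp.
by rewrite (Dn_chain_link _ mab'); congr dclass; apply: link_eq; apply: embn_comp.
Qed.

Lemma delete_rest m s i j k (a : hom (Pn (S (S m)) C) k i) (ma : mono a)
    (mFa : mono (delete m s O C k i a)) (c : hom (Pn (S (S m)) C) k j) :
  2 <= s <= S (S m) ->
  delete (S m) s O C i j (dclass (Link a ma c))
    = dclass (Link (delete m s O C k i a) mFa (delete m s O C k j c)).
Proof.
move=> hs; have [a0 [ma0 ea]] := mono_embnP ma; subst a.
rewrite -(Dn_reprK c) deleteE -(Dn_chain_link (n := S (S m)) ma0) deleteE.
rewrite delete_at_rest; first by lia.
have mea := embn_mono (n := S m) ma0.
rewrite (Dn_chain_link ma0 mea); congr dclass; apply: link_eq.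
by rewrite delete_embn.
Qed.

Lemma partializable_delete m s : 2 <= s <= S (S m) -> partializable (delete m s O C).
Proof.
elim: m => [|m IHm] hs.
  have -> : s = 2 by lia.
  by apply: (@partializable_flatten _ _ (adm_PB (catP (Pn 0 C)))
    (adm_PB (catP (Pn 1 C)))
    (Pn_CD_all (n := 0))) => *; apply: (delete_top (m := 0)).
have [-> | ns] := Nat.eq_dec s (S (S (S m))).
  by apply: (@partializable_flatten _ _ (adm_PB (catP (Pn (S m) C)))
    (adm_PB (catP (Pn (S (S m)) C)))
    (Pn_CD_all (n := S m))) => *; apply: (delete_top (m := S m)).
apply: (@partializable_lift _ _ id _ _ (adm_PB (catP (Pn (S (S m)) C)))
    (adm_PB (catP (Pn (S m) C)))
    (Pn_CD_all (n := S (S m))) (Pn_CD_all (n := S m)) (delete m s O C)).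
  by apply: IHm; lia.
by move=> *; apply: delete_rest; lia.
Qed.

End Transformations.

(** * Naturality, injectivity and surjectivity *)

Section Naturality.
Context (O O' : Type) (ob : O -> O') (C : Scat O) (D : Scat O').
Context (F : Smorphism ob C D).

Fixpoint chain_map n i j : chain n C i j -> chain n D (ob i) (ob j) :=
  match n return chain n C i j -> chain n D (ob i) (ob j) with
  | 0 => fun f => F _ _ f
  | S n => fun d => chain_link (Smor_mono (SmorP F) (legP d)) (chain_map (rest d))
  end.

Lemma chain_map_link n i j k (a : hom C k i) (ma : mono a) (r : chain n C k j) :
  chain_map (chain_link ma r) = chain_link (Smor_mono (SmorP F) ma) (chain_map r).
Proof. by []. Qed.

Lemma Pn_mor_embn n i j (f : hom C i j) :
  Pn_mor n F _ _ (embn n f) = embn n (F _ _ f).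
Proof. by elim: n => [|n IHn] //=; rewrite phom_map_emb IHn. Qed.

Lemma Pn_mor_Dn n i j (d : chain n C i j) : Pn_mor n F _ _ (Dn d) = Dn (chain_map d).
Proof.
elim: n i d => [|n IHn] i d //; have [k [a [ma [r ->]]]] := chainP d.
rewrite /= phom_mapE /diagram_map /= IHn; congr dclass; apply: link_eq.
exact: Pn_mor_embn.
Qed.

Lemma chain_map_cons_id n i j (d : chain n C i j) :
  chain_map (cons_id d) = cons_id (chain_map d).
Proof. by apply: link_eq; rewrite /= (Smor_id (SmorP F)). Qed.

Lemma chain_map_double_at n s i j (d : chain n C i j) : 1 <= s <= S n ->
  chain_map (double_at s d) = double_at s (chain_map d).
Proof.
elim: n i d => [|n IHn] i d hs.
  have -> : s = 1 by lia.
  by rewrite !double_at_top chain_map_cons_id.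
have [-> | ns] := Nat.eq_dec s (S (S n)).
  by rewrite !double_at_top chain_map_cons_id.
have [k [a [ma [r ->]]]] := chainP d.
by rewrite chain_map_link !double_at_rest ?chain_map_link ?IHn //; lia.
Qed.

Lemma chain_map_delete_at_top m i j (d : chain (S (S m)) C i j) :
  chain_map (delete_at (S (S m)) d) = delete_at (S (S m)) (chain_map d).
Proof.
have [k [a [ma [c ->]]]] := chainP d; have [l [b [mb [r ->]]]] := chainP c.
rewrite !chain_map_link !delete_at_top.
by apply: link_eq; rewrite (Smor_comp (SmorP F)).
Qed.

Lemma chain_map_delete_at m s i j (d : chain (S (S m)) C i j) : 2 <= s <= S (S m) ->
  chain_map (delete_at s d) = delete_at s (chain_map d).
Proof.
elim: m i d => [|m IHm] i d hs.
  have -> : s = 2 by lia.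
  exact: chain_map_delete_at_top.
have [-> | ns] := Nat.eq_dec s (S (S (S m))); first exact: chain_map_delete_at_top.
have [k [a [ma [r ->]]]] := chainP d.
by rewrite chain_map_link !delete_at_rest ?chain_map_link ?IHm //; lia.
Qed.

End Naturality.

Lemma double_natural n s : 1 <= s <= S n -> natural_transformation (double n s).
Proof.
move=> hs; split=> [O C|O O' ob C D F i j c]; first exact: partializable_double.
by rewrite -(Dn_reprK c) Pn_mor_Dn !doubleE Pn_mor_Dn chain_map_double_at.
Qed.

Lemma delete_natural m s : 2 <= s <= S (S m) -> natural_transformation (delete m s).
Proof.
move=> hs; split=> [O C|O O' ob C D F i j c]; first exact: partializable_delete.
by rewrite -(Dn_reprK c) Pn_mor_Dn !deleteE Pn_mor_Dn chain_map_delete_at.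
Qed.

Lemma delete_S_double m s O (C : Scat O) i j (c : hom (Pn (S m) C) i j) :
  1 <= s <= S m ->
  delete m (S s) O C i j (double (S m) s O C i j c) = c.
Proof.
by move=> hs; rewrite -(Dn_reprK c) doubleE deleteE delete_at_S_double_at.
Qed.

(** A doubling at [s] is undone by the deletion at [s], except for [s = 1], where
    only the deletion at [2] is available. *)
Lemma double_injective n s : 1 <= n -> 1 <= s <= S n ->
  injective_transformation (double n s).
Proof.
case: n => [|m] hn hs; first by lia.
have [r rK] : exists r, forall O (C : Scat O) i j (c : hom (Pn (S m) C) i j),
    delete m r O C i j (double (S m) s O C i j c) = c.
  have [-> | ns] := Nat.eq_dec s 1.
    by exists 2 => *; apply: delete_S_double; lia.
  by exists s => *; apply: delete_double; lia.
by move=> O C i j x y e; rewrite -(rK _ _ _ _ x) e rK.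
Qed.

Lemma delete_surjective m s : 2 <= s <= S (S m) ->
  surjective_transformation (delete m s).
Proof.
move=> hs O C i j c; exists (double (S m) s O C i j c); exact: delete_double.
Qed.

Theorem proposition22 :
  (* (i) *)
  (forall n s : nat, 1 <= n -> 1 <= s <= n + 1 ->
     natural_transformation (double n s) /\
     injective_transformation (double n s)) /\
  (* (ii); [delete m] is defined on [P^(m + 2)] *)
  (forall n m s : nat, n = S (S m) -> 2 <= s <= n ->
     natural_transformation (delete m s) /\
     surjective_transformation (delete m s)) /\
  (* (iii) *)
  (forall n m s : nat, n = S m -> 1 <= s <= n + 1 -> 2 <= s <= n + 1 ->
     eq_transformation
       (comp_transformation (delete m s) (double (S m) s))
       (id_transformation (S m))) /\
  (forall n m s : nat, n = S m -> 1 <= s <= n + 1 -> 2 <= s + 1 <= n + 1 ->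
     eq_transformation
       (comp_transformation (delete m (s + 1)) (double (S m) s))
       (id_transformation (S m))) /\
  (* (iv) *)
  (forall n m r s : nat, n = S (S m) ->
     1 <= s <= n + 1 -> 2 <= r <= n + 1 -> s + 1 < r ->
     eq_transformation
       (comp_transformation (delete (S m) r) (double (S (S m)) s))
       (comp_transformation (double (S m) s) (delete m (r - 1)))) /\
  (* (v) *)
  (forall n m r s : nat, n = S (S m) ->
     1 <= s <= n + 1 -> 2 <= r <= n + 1 -> r < s ->
     eq_transformation
       (comp_transformation (delete (S m) r) (double (S (S m)) s))
       (comp_transformation (double (S m) (s - 1)) (delete m r))).
Proof.
split.
  by move=> n s hn hs; split; [apply: double_natural | apply: double_injective]; lia.
split.
  by move=> n m s en hs; split; [apply: delete_natural | apply: delete_surjective]; lia.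
split; first by move=> n m s en hs hs' O C i j c; apply: delete_double; lia.
split.
  by move=> n m s en hs hs' O C i j c; rewrite Nat.add_1_r; apply: delete_S_double; lia.
split=> n m r s en hs hr hrs O C i j c.
all: rewrite /comp_transformation -(Dn_reprK c) doubleE !deleteE doubleE; congr Dn.
- by apply: delete_at_above_double_at; lia.
- by apply: delete_at_below_double_at; lia.
Qed.
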